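(* Let $\mathcal{A}$ and $\mathcal{B}$ be Banach algebras. Assume that the character spaces of $\mathcal{A}$ and $\mathcal{B}$ are non-empty. (i) If $\mathcal{A}\widehat{\otimes}\mathcal{B}$ is approximately cyclic amenable, then so are $\mathcal{A}$ and $\mathcal{B}$. (ii) If $\mathcal{A}$ is commutative and $\mathcal{A}\widehat{\otimes}\mathcal{A}$ is approximately cyclic amenable, then $\mathcal{A}$ is approximately cyclic amenable.
   Context: Banach algebras are over $\mathbb{C}$ and need not be unital. For a Banach algebra $\mathcal{A}$, the dual $\mathcal{A}^{*}$ is a Banach $\mathcal{A}$-bimodule via $\langle a\cdot x^{*},x\rangle=\langle x^{*},xa\rangle$ and $\langle x^{*}\cdot a,x\rangle=\langle x^{*},ax\rangle$ for $a,x\in\mathcal{A}$, $x^*\in\mathcal{A}^*$. A derivation $D:\mathcal{A}\to\mathcal{A}^{*}$ is a bounded linear map with $D(ab)=D(a)\cdot b+a\cdot D(b)$ for all $a,b\in\mathcal{A}$. It is cyclic if $\langle D(a),b\rangle+\langle D(b),a\rangle=0$ for all $a,b\in\mathcal{A}$. It is approximately inner if there is a net $(x_\alpha)\subseteq\mathcal{A}^{*}$ (not required to be bounded) with $D(a)=\lim_\alpha(a\cdot x_\alpha-x_\alpha\cdot a)$ in norm for every $a\in\mathcal{A}$. $\mathcal{A}$ is approximately cyclic amenable if every cyclic derivation $D:\mathcal{A}\to\mathcal{A}^{*}$ is approximately inner. A character on $\mathcal{A}$ is a non-zero homomorphism from $\mathcal{A}$ into $\mathbb{C}$; the character space is the set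 of all characters. $\mathcal{A}\widehat{\otimes}\mathcal{B}$ is the projective tensor product, a Banach algebra with product determined by $(a\otimes b)(c\otimes d)=ac\otimes bd$. *)

(* Defs.v *)
From HB Require Import structures.
From mathcomp Require Import all_boot all_order all_algebra.
From mathcomp Require Import complex.
From mathcomp Require Import ring lra.
From mathcomp Require Import all_classical all_reals.
From mathcomp Require Import topology normedtype sequences.

Set Implicit Arguments.
Unset Strict Implicit.
Unset Printing Implicit Defensive.

Import Order.TTheory GRing.Theory Num.Theory.
Import numFieldNormedType.Exports.

Local Open Scope classical_set_scope.
Local Open Scope ring_scope.
Local Open Scope complex_scope.

(* Norms on modules over R[i] take values in R[i]; suprema, infima and limits
   are formed in R, through the real part [nrm] of the norm. *)
Section RealNorm.
Variable R : realType.

Lemma norm_ReK (V : normedZmodType R[i]) (x : V) : (complex.Re `|x|)%:C = `|x|.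
Proof. by apply: RRe_real; rewrite normr_real. Qed.

Definition nrm (V : normedZmodType R[i]) (x : V) : R := complex.Re `|x|.

Lemma nrmE (V : normedZmodType R[i]) (x : V) : (nrm x)%:C = `|x|.
Proof. exact: norm_ReK. Qed.

Lemma nrm_le (V W : normedZmodType R[i]) (x : V) (y : W) :
  (nrm x <= nrm y) = (`|x| <= `|y|).
Proof. by rewrite -lecR !nrmE. Qed.

Lemma nrm_ge0 (V : normedZmodType R[i]) (x : V) : 0 <= nrm x.
Proof. by rewrite -lecR nrmE normr_ge0. Qed.

Lemma nrmD (V : normedZmodType R[i]) (x y : V) : nrm (x + y) <= nrm x + nrm y.
Proof. by rewrite -lecR rmorphD /= !nrmE ler_normD. Qed.

Lemma nrm0 (V : normedZmodType R[i]) : nrm (0 : V) = 0.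
Proof. by rewrite /nrm normr0. Qed.

Lemma nrm0_eq0 (V : normedZmodType R[i]) (x : V) : nrm x = 0 -> x = 0.
Proof. by move=> x0; apply/normr0_eq0; rewrite -nrmE x0. Qed.

Lemma nrmN (V : normedZmodType R[i]) (x : V) : nrm (- x) = nrm x.
Proof. by rewrite /nrm normrN. Qed.

Lemma nrmM (k l : R[i]) : nrm (k * l) = nrm k * nrm l.
Proof.
by apply: (@complexI R); rewrite rmorphM /= !nrmE normrM.
Qed.

Lemma nrmZ (V : normedModType R[i]) (k : R[i]) (x : V) :
  nrm (k *: x) = nrm k * nrm x.
Proof. by apply: (@complexI R); rewrite rmorphM /= !nrmE normrZ. Qed.

Lemma nrmC (r : R) : 0 <= r -> nrm (r%:C) = r.
Proof. by move=> r0; apply: (@complexI R); rewrite nrmE ger0_norm // lecR. Qed.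

Lemma nrm_sum (V : normedZmodType R[i]) I (s : seq I) (F : I -> V) :
  nrm (\sum_(i <- s) F i) <= \sum_(i <- s) nrm (F i).
Proof.
elim: s => [|i s IH]; first by rewrite !big_nil nrm0.
by rewrite !big_cons (le_trans (nrmD _ _)) // lerD2l.
Qed.

End RealNorm.

(* Hausdorff completion of a seminormed space: Cauchy sequences modulo null
   sequences, with norm the limit of the seminorms. *)
Record seminorm (R : realType) (V : lmodType R[i]) := Seminorm {
  sn :> V -> R;
  snD : forall x y, sn (x + y) <= sn x + sn y;
  snZ : forall k x, sn (k *: x) = nrm k * sn x }.

Section Completion.
Variables (R : realType) (V : lmodType R[i]) (p : seminorm V).

Lemma sn0 : p 0 = 0.
Proof. by rewrite -(scale0r 0) snZ nrm0 mul0r. Qed.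

Lemma snN x : p (- x) = p x.
Proof. by rewrite -scaleN1r snZ /nrm normrN normr1 mul1r. Qed.

Lemma sn_ge0 x : 0 <= p x.
Proof.
have : p (x - x) <= p x + p (- x) by exact: snD.
by rewrite subrr sn0 snN -mulr2n pmulrn_lge0.
Qed.

Lemma snB x y : p (x - y) = p (y - x).
Proof. by rewrite -opprB snN. Qed.

Lemma sn_dist x y : `|p x - p y| <= p (x - y).
Proof.
rewrite ler_norml lerNl opprB; apply/andP; split; rewrite lerBlDr.
  by have := snD p (y - x) x; rewrite subrK snB.
by have := snD p (x - y) y; rewrite subrK.
Qed.

Definition cauchy_seq (u : nat -> V) : bool :=
  `[< forall e : R, 0 < e ->
      exists N, forall m n, (N <= m)%N -> (N <= n)%N -> p (u m - u n) < e >].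

Lemma cauchy_seq_closed : submod_closed cauchy_seq.
Proof.
split=> [|k u v /asboolP cu /asboolP cv]; apply/asboolP => e e0.
  by exists 0%N => m n _ _; rewrite subrr sn0.
have k1 : 0 < nrm k + 1 by rewrite ltr_wpDl // nrm_ge0.
have [N1 H1] := cu (e / 2 / (nrm k + 1)) (divr_gt0 (divr_gt0 e0 (ltr0Sn _ 1)) k1).
have [N2 H2] := cv (e / 2) (divr_gt0 e0 (ltr0Sn _ 1)).
exists (maxn N1 N2) => m n; rewrite !geq_max => /andP[m1 m2] /andP[n1 n2].
rewrite [X in p X](_ : _ = k *: (u m - u n) + (v m - v n)); last first.
  by rewrite scalerBr opprD addrACA.
apply: le_lt_trans (snD _ _ _) _; rewrite snZ [e]splitr ltr_leD //; last first.
  by rewrite ltW // H2.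
have [->|pu0] := eqVneq (p (u m - u n)) 0; first by rewrite mulr0 divr_gt0.
apply: (@lt_trans _ _ ((nrm k + 1) * p (u m - u n))).
  by rewrite ltr_pM2r ?ltrDl // lt_def pu0 sn_ge0.
by rewrite mulrC -ltr_pdivlMr // H1.
Qed.

HB.instance Definition _ := GRing.isSubmodClosed.Build R[i] (nat -> V)
  cauchy_seq (GRing.submod_closed_semi cauchy_seq_closed).

Record cauchySeq := CauchySeq { cs_val :> nat -> V; _ : cauchy_seq cs_val }.
HB.instance Definition _ := [isSub for cs_val].
HB.instance Definition _ := [Choice of cauchySeq by <:].
HB.instance Definition _ := [SubChoice_isSubLmodule of cauchySeq by <:].

Implicit Types u v w : cauchySeq.

Lemma cauchySeqP u (e : R) : 0 < e ->
  exists N, forall m n, (N <= m)%N -> (N <= n)%N -> p (u m - u n) < e.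
Proof. by case: u => u /= /asboolP; apply. Qed.

Definition lim_sn u : R := limn (fun n => p (u n)).

Lemma lim_snP u : (fun n => p (u n)) @ \oo --> lim_sn u.
Proof.
apply: R_complete; apply/cauchy_ballP => e e0; near_simpl.
have [N H] := cauchySeqP u e0.
exists ([set n | (N <= n)%N], [set n | (N <= n)%N]) => /=.
  by split; exists N.
case=> m n /= [Nm Nn].
by rewrite /ball /=; apply: le_lt_trans (sn_dist _ _) _; apply: H.
Unshelve. all: by end_near. Qed.

Lemma lim_sn_unique u l : (fun n => p (u n)) @ \oo --> l -> lim_sn u = l.
Proof. by move=> /cvg_lim; apply. Qed.

Lemma lim_snD u v : lim_sn (u + v) <= lim_sn u + lim_sn v.
Proof.
have := @ler_cvg_to _ \oo _ R (fun n => p ((u + v) n)) (fun n => p (u n) + p (v n)).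
apply; [exact: lim_snP | exact: cvgD (@lim_snP u) (@lim_snP v) |].
by apply: nearW => n; exact: snD.
Qed.

Lemma lim_snZ k u : lim_sn (k *: u) = nrm k * lim_sn u.
Proof.
apply: lim_sn_unique.
rewrite (_ : (fun n => p ((k *: u) n)) = (fun n => nrm k * p (u n))); last first.
  by apply/funext => n; exact: snZ.
by apply: cvgMr; exact: lim_snP.
Qed.

Definition lim_seminorm := Seminorm lim_snD lim_snZ.

End Completion.

Arguments lim_snP {R V p} u.

Section CompletionModule.
Variables (R : realType) (V : lmodType R[i]) (p : seminorm V).
Local Notation CS := (cauchySeq p).
Local Notation q := (lim_seminorm p).
Implicit Types u v w : CS.

Definition null_eq : rel CS := fun u v => q (u - v) == 0.

Lemma null_eq_equiv : equiv_class_of null_eq.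
Proof.
split=> [u|u v|v u w]; rewrite /null_eq.
- by rewrite subrr sn0.
- by rewrite snB.
- move=> /eqP uv /eqP vw; rewrite eq_le sn_ge0 andbT.
  by rewrite -(subrK v u) -addrA (le_trans (snD q _ _)) // uv vw addr0.
Qed.

Canonical null_eq_rel := EquivRelPack null_eq_equiv.

Definition completion : Type := {eq_quot null_eq_rel}%qT.
HB.instance Definition _ := Choice.on completion.

Definition cls (u : CS) : completion := (\pi_({eq_quot null_eq_rel}) u)%qT.
Definition rep (x : completion) : CS := repr (x : {eq_quot null_eq_rel}%qT).

Lemma repK x : cls (rep x) = x.
Proof. exact: reprK. Qed.

Lemma clsP u v : cls u = cls v <-> q (u - v) = 0.
Proof.
split=> [/eqP|uv]; first by rewrite /cls eqquotE => /eqP.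
by apply/eqP; rewrite /cls eqquotE; apply/eqP.
Qed.

Lemma rep_cls u : q (rep (cls u) - u) = 0.
Proof. by apply/clsP; rewrite repK. Qed.

Lemma clsW (P : completion -> Prop) : (forall u, P (cls u)) -> forall x, P x.
Proof. by move=> H x; rewrite -(repK x). Qed.

Definition cadd x y := cls (rep x + rep y).
Definition copp x := cls (- rep x).
Definition cscale k x := cls (k *: rep x).

Lemma cls_add u v : cadd (cls u) (cls v) = cls (u + v).
Proof.
apply/clsP/eqP; rewrite eq_le sn_ge0 andbT opprD addrACA.
by rewrite (le_trans (snD q _ _)) // !rep_cls addr0.
Qed.

Lemma cls_opp u : copp (cls u) = cls (- u).
Proof. by apply/clsP; rewrite -opprD snN rep_cls. Qed.

Lemma cls_scale k u : cscale k (cls u) = cls (k *: u).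
Proof. by apply/clsP; rewrite -scalerBr snZ rep_cls mulr0. Qed.

Lemma caddA : associative cadd.
Proof.
by elim/clsW => u; elim/clsW => v; elim/clsW => w; rewrite !cls_add addrA.
Qed.

Lemma caddC : commutative cadd.
Proof. by elim/clsW => u; elim/clsW => v; rewrite !cls_add addrC. Qed.

Lemma cadd0 : left_id (cls 0) cadd.
Proof. by elim/clsW => u; rewrite cls_add add0r. Qed.

Lemma caddN : left_inverse (cls 0) copp cadd.
Proof. by elim/clsW => u; rewrite cls_opp cls_add addNr. Qed.

HB.instance Definition _ :=
  GRing.isZmodule.Build completion caddA caddC cadd0 caddN.

Lemma clsD u v : cls (u + v) = cls u + cls v.
Proof. by rewrite -cls_add. Qed.

Lemma clsN u : cls (- u) = - cls u.
Proof. by rewrite -cls_opp. Qed.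

Lemma cscaleA a b x : cscale a (cscale b x) = cscale (a * b) x.
Proof. by elim/clsW: x => u; rewrite !cls_scale scalerA. Qed.

Lemma cscale1 : left_id 1 cscale.
Proof. by elim/clsW => u; rewrite cls_scale scale1r. Qed.

Lemma cscaleDr : right_distributive cscale +%R.
Proof.
move=> a; elim/clsW => u; elim/clsW => v.
by rewrite -clsD !cls_scale scalerDr clsD.
Qed.

Lemma cscaleDl x : {morph cscale^~ x : a b / a + b}.
Proof. by elim/clsW: x => u a b; rewrite !cls_scale scalerDl clsD. Qed.

HB.instance Definition _ :=
  GRing.Zmodule_isLmodule.Build R[i] completion cscaleA cscale1 cscaleDr cscaleDl.

Lemma clsZ k u : cls (k *: u) = k *: cls u.
Proof. by rewrite -cls_scale. Qed.

Definition cnorm (x : completion) : R[i] := (q (rep x))%:C.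

Lemma cls_norm u : cnorm (cls u) = (q u)%:C.
Proof.
congr (_%:C); apply/eqP; rewrite -subr_eq0 -normr_le0.
by rewrite (le_trans (sn_dist _ _ _)) // rep_cls.
Qed.

Lemma cnormD x y : cnorm (x + y) <= cnorm x + cnorm y.
Proof.
elim/clsW: x => u; elim/clsW: y => v.
by rewrite -clsD !cls_norm -rmorphD lecR snD.
Qed.

Lemma cnormZ k x : cnorm (k *: x) = `|k| * cnorm x.
Proof. by elim/clsW: x => u; rewrite -clsZ !cls_norm snZ rmorphM /= nrmE. Qed.

Lemma cnorm0_eq0 x : cnorm x = 0 -> x = 0.
Proof.
elim/clsW: x => u; rewrite cls_norm => /complexI qu.
by apply/clsP; rewrite subr0.
Qed.

HB.instance Definition _ :=
  Lmodule_isNormed.Build R[i] completion cnormD cnormZ cnorm0_eq0.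

Lemma nrm_cls u : nrm (cls u) = q u.
Proof. by apply: (@complexI R); rewrite nrmE -cls_norm. Qed.

End CompletionModule.

Section CompletionComplete.
Variables (R : realType) (V : lmodType R[i]) (p : seminorm V).
Local Notation CS := (cauchySeq p).
Local Notation q := (lim_seminorm p).

Lemma cauchy_cst (x : V) : cauchy_seq p (fun=> x).
Proof. by apply/asboolP => e e0; exists 0%N => m n _ _; rewrite subrr sn0. Qed.

Definition cemb (x : V) : completion p := cls (CauchySeq (cauchy_cst x)).

Lemma nrm_cemb x : nrm (cemb x) = p x.
Proof. by rewrite nrm_cls; apply: lim_sn_unique => /=; exact: cvg_cst. Qed.

Lemma cembD x y : cemb (x + y) = cemb x + cemb y.
Proof. by rewrite -clsD; congr cls; apply: val_inj. Qed.

Lemma cembZ k x : cemb (k *: x) = k *: cemb x.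
Proof. by rewrite -clsZ; congr cls; apply: val_inj. Qed.

Lemma cembN x : cemb (- x) = - cemb x.
Proof. by rewrite -scaleN1r cembZ scaleN1r. Qed.

Lemma cls_cemb_le (u : CS) N (e : R) :
  (forall n, (N <= n)%N -> p (u n - u N) <= e) -> nrm (cls u - cemb (u N)) <= e.
Proof.
move=> H; rewrite -clsN -clsD nrm_cls.
apply: (@ler_cvg_to _ \oo _ R _ (fun=> e) _ _ (lim_snP _)); first exact: cvg_cst.
by exists N => // n /= Nn; exact: H.
Qed.

Lemma cemb_dense x (e : R) : 0 < e -> exists v, nrm (x - cemb v) <= e.
Proof.
move=> e0; elim/clsW: x => u; have [N HN] := cauchySeqP u e0.
by exists (u N); apply: cls_cemb_le => n Nn; rewrite ltW // HN.
Qed.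

Lemma small_inv (e : R) : 0 < e -> exists N, N.+1%:R^-1 < e.
Proof.
move=> e0; exists (Num.bound e^-1); rewrite invf_plt ?posrE //.
apply: lt_trans (archi_boundP _) _; first by rewrite invr_ge0 ltW.
by rewrite ltr_nat.
Qed.

Lemma completion_complete (F : set_system (completion p)) :
  ProperFilter F -> cauchy F -> cvg F.
Proof.
move=> FF /cauchyP Fc.
have inv0 n : 0 < n.+1%:R^-1 :> R by rewrite invr_gt0.
have approx n : exists v, F [set y | nrm (y - cemb v) < n.+1%:R^-1].
  have h0 : 0 < n.+1%:R^-1 / 2 :> R by rewrite divr_gt0.
  have [x Fx] : exists x, F (ball x (n.+1%:R^-1 / 2 : R)%:C) by apply: Fc; rewrite ltcR.
  have [v xv] := cemb_dense x h0; exists v.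
  apply: filterS Fx => y; rewrite -ball_normE /= -nrmE ltcR => xy.
  rewrite -(subrK x y) -addrA (le_lt_trans (nrmD _ _)) // [ltRHS]splitr.
  by rewrite ltr_leD // -nrmN opprB.
have [v Hv] := choice approx.
have vv m n : p (v m - v n) < m.+1%:R^-1 + n.+1%:R^-1.
  have [y [/= y1 y2]] := filter_ex (filterI (Hv m) (Hv n)).
  rewrite -nrm_cemb cembD cembN -(subrK y (cemb (v m))) -addrA.
  by rewrite (le_lt_trans (nrmD _ _)) // ltrD // -nrmN opprB.
have cv : cauchy_seq p v.
  apply/asboolP => e e0.
  have [N HN] := small_inv (divr_gt0 e0 (ltr0Sn R 1)).
  exists N => m n Nm Nn; apply: lt_le_trans (vv m n) _; rewrite [e]splitr.
  by rewrite lerD // (le_trans _ (ltW HN)) // lef_pV2 ?posrE // ler_nat ltnS.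
apply/cvg_ex; exists (cls (CauchySeq cv)); apply/fcvgrPdist_lt => E E0.
pose e := complex.Re E.
have Ee : E = e%:C by rewrite RRe_real // ger0_real // ltW.
have e0 : 0 < e by rewrite -ltcR -Ee.
have e20 : 0 < e / 2 / 2 by rewrite !divr_gt0.
have [N HN] := small_inv e20.
near=> y.
rewrite Ee -nrmE ltcR -(subrK (cemb (v N)) (cls _)) -addrA.
rewrite (le_lt_trans (nrmD _ _)) // [ltRHS]splitr ler_ltD //.
  apply: (@cls_cemb_le (CauchySeq cv)) => n Nn /=.
  apply: le_trans (ltW (vv _ _)) _; rewrite [leRHS]splitr lerD ?(ltW HN) //.
  by rewrite (le_trans _ (ltW HN)) // lef_pV2 ?posrE // ler_nat ltnS.
rewrite -nrmN opprB; apply: (@lt_trans _ _ N.+1%:R^-1); last first.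
  by rewrite (lt_trans HN) // ltr_pdivrMr // ltr_pMr ?divr_gt0 // ltr1n.
near: y; exact: Hv.
Unshelve. all: by end_near. Qed.

HB.instance Definition _ :=
  Uniform_isComplete.Build (completion p) completion_complete.

End CompletionComplete.

HB.mixin Record isBanachAlgebra (K : numFieldType) A
    & CompleteNormedModule K A := {
  bmul : A -> A -> A;
  bmulA : associative bmul;
  bmulDl : left_distributive bmul +%R;
  bmulDr : right_distributive bmul +%R;
  bmulZl : forall k a b, bmul (k *: a) b = k *: bmul a b;
  bmulZr : forall k a b, bmul a (k *: b) = k *: bmul a b;
  bnormM : forall a b, `|bmul a b| <= `|a| * `|b|
}.

(* No unit is assumed. *)
#[short(type="banachAlgType")]
HB.structure Definition BanachAlgebra (K : numFieldType) :=
  {A of CompleteNormedModule K A & isBanachAlgebra K A}.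

Declare Scope banach_scope.
Delimit Scope banach_scope with B.
Local Open Scope banach_scope.

Notation "a ** b" := (bmul a b) (at level 40, left associativity) : banach_scope.

Section BanachAlgebraTheory.
Variables (R : realType) (A : banachAlgType R[i]).
Implicit Types a b : A.

Lemma bmul0l b : (0 : A) ** b = 0.
Proof. by rewrite -(@scale0r R[i] A 0) bmulZl !scale0r. Qed.

Lemma bmul0r a : a ** (0 : A) = 0.
Proof. by rewrite -(@scale0r R[i] A 0) bmulZr !scale0r. Qed.

Lemma nrmM_le a b : nrm (a ** b) <= nrm a * nrm b.
Proof. by rewrite -lecR rmorphM /= !nrmE bnormM. Qed.

End BanachAlgebraTheory.

Section Dual.
Variables (R : realType) (V : normedModType R[i]).

Definition bounded_functional (f : V -> R[i]) : bool :=
  `[< scalar f /\ exists M : R, forall x, nrm (f x) <= M * nrm x >].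

Lemma bounded_functional_closed : submod_closed bounded_functional.
Proof.
split=> [|k f g /asboolP[lf [M Mf]] /asboolP[lg [N Ng]]]; apply/asboolP; split.
- by move=> a x y /=; rewrite mulr0 addr0.
- by exists 0 => x; rewrite nrm0 mul0r.
- move=> a x y; rewrite !fctE /= lf lg /GRing.scale /=; ring.
exists (nrm k * M + N) => x; rewrite !fctE (le_trans (nrmD _ _)) // mulrDl.
by rewrite lerD // nrmM -mulrA ler_wpM2l // nrm_ge0.
Qed.

HB.instance Definition _ := GRing.isSubmodClosed.Build R[i] (V -> R[i])
  bounded_functional (GRing.submod_closed_semi bounded_functional_closed).

Record dual :=
  Dual { dual_val :> V -> R[i]; dual_valP : bounded_functional dual_val }.
HB.instance Definition _ := [isSub for dual_val].
HB.instance Definition _ := [Choice of dual by <:].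
HB.instance Definition _ := [SubChoice_isSubLmodule of dual by <:].

Implicit Types f g : dual.

Lemma dual_scalar f : scalar f.
Proof. by case: f => f /= /asboolP[]. Qed.

Lemma dualD f g x : (f + g) x = f x + g x.
Proof. by []. Qed.

Lemma dualZ k f x : (k *: f) x = k * f x.
Proof. by []. Qed.

Lemma dual_eq f g : (forall x, f x = g x) -> f = g.
Proof. by move=> fg; apply: val_inj; apply/funext. Qed.

Lemma dual0 f : f 0 = 0.
Proof. by have := dual_scalar f (-1) 0 0; rewrite scaler0 addr0 mulN1r addNr. Qed.

Lemma dual_lZ f k x : f (k *: x) = k * f x.
Proof. by have := dual_scalar f k x 0; rewrite !addr0 dual0 addr0. Qed.

Lemma dual_lD f x y : f (x + y) = f x + f y.
Proof. by have := dual_scalar f 1 x y; rewrite scale1r mul1r. Qed.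

Definition dual_rnorm f : R := sup [set nrm (f x) | x in [set x | nrm x <= 1]].

Lemma dual_has_sup f : has_sup [set nrm (f x) | x in [set x | nrm x <= 1]].
Proof.
split; first by exists (nrm (f 0)), 0; rewrite //= nrm0.
case: f => f /= /asboolP[_ [M HM]]; exists (Num.max M 0) => _ [x /= x1 <-].
apply: le_trans (HM x) _.
apply: (@le_trans _ _ (Num.max M 0 * nrm x)).
  by rewrite ler_wpM2r ?nrm_ge0 // le_max lexx.
by rewrite ler_piMr // le_max lexx orbT.
Qed.

Lemma dual_rnorm_ge0 f : 0 <= dual_rnorm f.
Proof.
apply: (@le_trans _ _ (nrm (f 0))); first exact: nrm_ge0.
by apply: sup_upper_bound; [exact: dual_has_sup | exists 0; rewrite //= nrm0].
Qed.

Lemma dual_rnormP f x : nrm (f x) <= dual_rnorm f * nrm x.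
Proof.
have [/nrm0_eq0 ->|x0] := eqVneq (nrm x) 0; first by rewrite dual0 !nrm0 mulr0.
have xp : 0 < nrm x by rewrite lt_def x0 nrm_ge0.
rewrite -ler_pdivrMr // mulrC.
have ni : nrm ((nrm x)^-1%:C : R[i]) = (nrm x)^-1 by rewrite nrmC // invr_ge0 ltW.
rewrite -{1}ni -nrmM -dual_lZ.
apply: sup_upper_bound; first exact: dual_has_sup.
by exists ((nrm x)^-1%:C *: x) => //=; rewrite nrmZ ni mulVf.
Qed.

Lemma dual_rnorm_le f M : 0 <= M -> (forall x, nrm (f x) <= M * nrm x) ->
  dual_rnorm f <= M.
Proof.
move=> M0 HM; apply: ge_sup; first by case: (dual_has_sup f).
move=> _ [x /= x1 <-]; apply: le_trans (HM x) _.
by rewrite ler_piMr.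
Qed.

Definition dual_norm f : R[i] := (dual_rnorm f)%:C.

Lemma dual_normD f g : dual_norm (f + g) <= dual_norm f + dual_norm g.
Proof.
rewrite -rmorphD lecR dual_rnorm_le ?addr_ge0 ?dual_rnorm_ge0 // => x.
by rewrite dualD (le_trans (nrmD _ _)) // mulrDl lerD // dual_rnormP.
Qed.

Lemma dual_rnormZ_le k f : dual_rnorm (k *: f) <= nrm k * dual_rnorm f.
Proof.
apply: dual_rnorm_le => [|x]; first by rewrite mulr_ge0 ?nrm_ge0 ?dual_rnorm_ge0.
by rewrite dualZ nrmM -mulrA ler_wpM2l ?nrm_ge0 ?dual_rnormP.
Qed.

Lemma dual_normZ k f : dual_norm (k *: f) = `|k| * dual_norm f.
Proof.
rewrite -nrmE -rmorphM; congr (_%:C); apply/eqP.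
rewrite eq_le dual_rnormZ_le /=.
have [->|k0] := eqVneq k 0; first by rewrite nrm0 mul0r dual_rnorm_ge0.
have kp : 0 < nrm k.
  by rewrite lt_def nrm_ge0 andbT; apply: contra_neq k0; exact: nrm0_eq0.
have := dual_rnormZ_le k^-1 (k *: f); rewrite scalerA mulVf // scale1r.
have -> : nrm k^-1 = (nrm k)^-1.
  by apply: (mulfI (lt0r_neq0 kp)); rewrite -nrmM !divff ?(lt0r_neq0 kp) // /nrm normr1.
by rewrite mulrC ler_pdivlMr // mulrC.
Qed.

Lemma dual_norm0_eq0 f : dual_norm f = 0 -> f = 0.
Proof.
move=> /complexI f0; apply: dual_eq => x; apply: nrm0_eq0; apply/eqP.
by rewrite eq_le nrm_ge0 andbT (le_trans (dual_rnormP f x)) // f0 mul0r.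
Qed.

HB.instance Definition _ :=
  Lmodule_isNormed.Build R[i] dual dual_normD dual_normZ dual_norm0_eq0.

Lemma nrm_dual f : nrm f = dual_rnorm f.
Proof. by []. Qed.

End Dual.


(* The algebraic tensor product of two normed spaces, as the span of the
   evaluations phi |-> phi a b in the functionals on bilinear forms. *)
Section AlgebraicTensor.
Variables (R : realType) (A B : normedModType R[i]).

Definition bform := {bilinear A -> B -> R[i] | *%R & *%R}.

Definition tens_eval (s : seq (A * B)) : bform -> R[i] :=
  fun phi => \sum_(ab <- s) phi ab.1 ab.2.

Definition is_tensor (u : bform -> R[i]) : bool := `[< exists s, u = tens_eval s >].

Definition tens_scale (k : R[i]) (s : seq (A * B)) := [seq (k *: ab.1, ab.2) | ab <- s].

Lemma tens_eval_cat s t : tens_eval (s ++ t) = tens_eval s + tens_eval t.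
Proof. by apply/funext => phi; rewrite /tens_eval big_cat. Qed.

Lemma tens_eval_scale k s : tens_eval (tens_scale k s) = k *: tens_eval s.
Proof.
apply/funext => phi; rewrite /tens_eval big_map /= /GRing.scale /=.
rewrite [RHS](big_distrr k) /=.
by apply: eq_bigr => ab _; rewrite linearZl_LR.
Qed.

Lemma is_tensor_closed : submod_closed is_tensor.
Proof.
split=> [|k u v /asboolP[s ->] /asboolP[t ->]]; apply/asboolP.
  by exists [::]; apply/funext => phi; rewrite /tens_eval big_nil.
by exists (tens_scale k s ++ t); rewrite tens_eval_cat tens_eval_scale.
Qed.

HB.instance Definition _ := GRing.isSubmodClosed.Build R[i] (bform -> R[i])
  is_tensor (GRing.submod_closed_semi is_tensor_closed).

Record algTensor :=
  AlgTensor { at_val :> bform -> R[i]; at_valP : is_tensor at_val }.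
HB.instance Definition _ := [isSub for at_val].
HB.instance Definition _ := [Choice of algTensor by <:].
HB.instance Definition _ := [SubChoice_isSubLmodule of algTensor by <:].

Lemma tens_sum_subproof s : is_tensor (tens_eval s).
Proof. by apply/asboolP; exists s. Qed.

(* The tensor represented by the formal sum s. *)
Definition tens_sum s : algTensor := AlgTensor (tens_sum_subproof s).

Implicit Types u v : algTensor.

Lemma algTensorP u : exists s, u = tens_sum s.
Proof. by case: u => u us; have /asboolP[s us'] := us; exists s; apply: val_inj. Qed.

Lemma tens_sum_cat s t : tens_sum (s ++ t) = tens_sum s + tens_sum t.
Proof. by apply: val_inj; rewrite /= tens_eval_cat. Qed.

Lemma tens_sum_scale k s : tens_sum (tens_scale k s) = k *: tens_sum s.
Proof. by apply: val_inj; rewrite /= tens_eval_scale. Qed.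

Definition cost (s : seq (A * B)) : R := \sum_(ab <- s) nrm ab.1 * nrm ab.2.

Definition proj_norm u : R := inf [set cost s | s in [set s | u = tens_sum s]].

Lemma cost_ge0 s : 0 <= cost s.
Proof. by apply: sumr_ge0 => ab _; rewrite mulr_ge0 ?nrm_ge0. Qed.

Lemma proj_norm_has_inf u : has_inf [set cost s | s in [set s | u = tens_sum s]].
Proof.
split; first by have [s us] := algTensorP u; exists (cost s), s.
by exists 0 => _ [s _ <-]; exact: cost_ge0.
Qed.

Lemma proj_norm_le s : proj_norm (tens_sum s) <= cost s.
Proof. by apply: ge_inf; [case: (proj_norm_has_inf (tens_sum s))|exists s]. Qed.

Lemma proj_norm_ge0 u : 0 <= proj_norm u.
Proof.
apply: lb_le_inf; first by case: (proj_norm_has_inf u).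
by move=> _ [s _ <-]; exact: cost_ge0.
Qed.

Lemma proj_norm_approx u (e : R) : 0 < e ->
  exists2 s, u = tens_sum s & cost s < proj_norm u + e.
Proof.
move=> e0; have [_ [s us <-] H] := inf_adherent e0 (proj_norm_has_inf u).
by exists s.
Qed.

Lemma cost_cat s t : cost (s ++ t) = cost s + cost t.
Proof. by rewrite /cost big_cat. Qed.

Lemma cost_scale k s : cost (tens_scale k s) = nrm k * cost s.
Proof.
by rewrite /cost big_map big_distrr /=; apply: eq_bigr => ab _; rewrite nrmZ mulrA.
Qed.

Lemma proj_normD u v : proj_norm (u + v) <= proj_norm u + proj_norm v.
Proof.
apply/ler_addgt0Pr => e e0.
have e20 : 0 < e / 2 by rewrite divr_gt0.
have [s -> Hs] := proj_norm_approx u e20.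
have [t -> Ht] := proj_norm_approx v e20.
rewrite -tens_sum_cat (le_trans (proj_norm_le _)) // cost_cat.
by rewrite [e]splitr addrACA lerD // ltW.
Qed.

Lemma proj_normZ_le k u : proj_norm (k *: u) <= nrm k * proj_norm u.
Proof.
have k1 : 0 < nrm k + 1 by rewrite ltr_wpDl // nrm_ge0.
apply/ler_addgt0Pr => e e0.
have [s us Hs] := proj_norm_approx u (divr_gt0 e0 k1).
rewrite {1}us -tens_sum_scale (le_trans (proj_norm_le _)) // cost_scale.
apply: (@le_trans _ _ (nrm k * (proj_norm u + e / (nrm k + 1)))).
  by rewrite ler_wpM2l ?nrm_ge0 // ltW.
rewrite mulrDr lerD2l mulrCA ger_pMr // ler_pdivrMr // mul1r lerDl //.
Qed.

Lemma proj_normZ k u : proj_norm (k *: u) = nrm k * proj_norm u.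
Proof.
apply/eqP; rewrite eq_le proj_normZ_le /=.
have [->|k0] := eqVneq k 0; first by rewrite nrm0 mul0r proj_norm_ge0.
have kp : 0 < nrm k.
  by rewrite lt_def nrm_ge0 andbT; apply: contra_neq k0; exact: nrm0_eq0.
have := proj_normZ_le k^-1 (k *: u); rewrite scalerA mulVf // scale1r.
have -> : nrm k^-1 = (nrm k)^-1.
  by apply: (mulfI (lt0r_neq0 kp)); rewrite -nrmM !divff ?(lt0r_neq0 kp) // /nrm normr1.
by rewrite mulrC ler_pdivlMr // mulrC.
Qed.

Definition proj_seminorm : seminorm algTensor := Seminorm proj_normD proj_normZ.

End AlgebraicTensor.

Section AlgebraicTensorProduct.
Variables (R : realType) (A B : banachAlgType R[i]).
Local Notation T := (algTensor A B).
Local Open Scope banach_scope.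

Definition bf_shift (phi : bform A B) (a : A) (b : B) : A -> B -> R[i] :=
  fun c d => phi (a ** c) (b ** d).

Lemma bf_shift_bilinear phi a b : bilinear_for *%R *%R (bf_shift phi a b).
Proof.
split=> [d k c c'|c k d d'] /=.
  by rewrite /bf_shift bmulDr bmulZr linearDl linearZl_LR.
by rewrite /bf_shift bmulDr bmulZr linearDr linearZr_LR.
Qed.

HB.instance Definition _ phi a b := bilinear_isBilinear.Build R[i] A B R[i]
  *%R *%R (bf_shift phi a b) (bf_shift_bilinear phi a b).

Definition bf_inner (phi : bform A B) (v : T) : A -> B -> R[i] :=
  fun a b => v (bf_shift phi a b : bform A B).

Lemma bf_innerE phi s a b :
  bf_inner phi (tens_sum s) a b = \sum_(cd <- s) phi (a ** cd.1) (b ** cd.2).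
Proof. by []. Qed.

Lemma bf_inner_bilinear phi v : bilinear_for *%R *%R (bf_inner phi v).
Proof.
have [s ->] := algTensorP v.
split=> [b k a a'|a k b b']; rewrite /bf_inner /= /tens_eval /bf_shift /=.
  rewrite big_distrr -big_split; apply: eq_bigr => cd _ /=.
  by rewrite /bf_shift bmulDl bmulZl linearDl linearZl_LR.
rewrite big_distrr -big_split; apply: eq_bigr => cd _ /=.
by rewrite /bf_shift bmulDl bmulZl linearDr linearZr_LR.
Qed.

HB.instance Definition _ phi v := bilinear_isBilinear.Build R[i] A B R[i]
  *%R *%R (bf_inner phi v) (bf_inner_bilinear phi v).

Definition tmul_seq (s t : seq (A * B)) : seq (A * B) :=
  [seq (ab.1 ** cd.1, ab.2 ** cd.2) | ab <- s, cd <- t].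

Definition tmul_fun (u v : T) : bform A B -> R[i] :=
  fun phi => u (bf_inner phi v : bform A B).

Lemma tmul_funE s t : tmul_fun (tens_sum s) (tens_sum t) = tens_eval (tmul_seq s t).
Proof. by apply/funext => phi; rewrite /tens_eval big_allpairs_dep. Qed.

Lemma tmul_subproof u v : is_tensor (tmul_fun u v).
Proof.
have [s ->] := algTensorP u; have [t ->] := algTensorP v.
by rewrite tmul_funE tens_sum_subproof.
Qed.

(* The product with (a (x) b)(c (x) d) = ac (x) bd, by [tmul_sum] below. *)
Definition tmul (u v : T) : T := AlgTensor (tmul_subproof u v).

Lemma tmul_sum s t : tmul (tens_sum s) (tens_sum t) = tens_sum (tmul_seq s t).
Proof. by apply: val_inj; rewrite /= tmul_funE. Qed.

Lemma tmulDl u v w : tmul (u + v) w = tmul u w + tmul v w.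
Proof. exact: val_inj. Qed.

Lemma tmulZl k u w : tmul (k *: u) w = k *: tmul u w.
Proof. exact: val_inj. Qed.

Lemma at_valD (u : T) (phi psi chi : bform A B) :
  (forall a b, chi a b = phi a b + psi a b) -> u chi = u phi + u psi.
Proof.
move=> H; have [s ->] := algTensorP u; rewrite /= /tens_eval -big_split /=.
by apply: eq_bigr => ab _; rewrite H.
Qed.

Lemma at_valZ k (u : T) (phi chi : bform A B) :
  (forall a b, chi a b = k * phi a b) -> u chi = k * u phi.
Proof.
move=> H; have [s ->] := algTensorP u; rewrite /= /tens_eval big_distrr /=.
by apply: eq_bigr => ab _; rewrite H.
Qed.

Lemma tmulDr u v w : tmul u (v + w) = tmul u v + tmul u w.
Proof. by apply: val_inj; apply/funext => phi; exact: (@at_valD u (bf_inner phi v) (bf_inner phi w) (bf_inner phi (v + w))). Qed.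

Lemma tmulZr k u w : tmul u (k *: w) = k *: tmul u w.
Proof. by apply: val_inj; apply/funext => phi; exact: (@at_valZ k u (bf_inner phi w) (bf_inner phi (k *: w))). Qed.

Lemma tmulA : associative tmul.
Proof.
move=> u v w; have [s ->] := algTensorP u; have [t ->] := algTensorP v.
have [r ->] := algTensorP w; rewrite !tmul_sum; apply: val_inj.
apply/funext => phi; rewrite /= /tens_eval !big_allpairs_dep /=.
apply: eq_bigr => ab _; rewrite big_allpairs_dep /=.
by apply: eq_bigr => cd _; apply: eq_bigr => ef _; rewrite !bmulA.
Qed.

Lemma cost_tmul s t : cost (tmul_seq s t) <= cost s * cost t.
Proof.
rewrite /cost big_allpairs_dep big_distrl /=; apply: ler_sum => ab _.
rewrite big_distrr /=; apply: ler_sum => cd _.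
by rewrite mulrACA ler_pM ?nrm_ge0 // nrmM_le.
Qed.

Lemma proj_normM u v : proj_norm (tmul u v) <= proj_norm u * proj_norm v.
Proof.
suff H (x y : R) : proj_norm u < x -> proj_norm v < y -> proj_norm (tmul u v) <= x * y.
  set a := proj_norm u; set b := proj_norm v.
  have a0 : 0 <= a by exact: proj_norm_ge0.
  have b0 : 0 <= b by exact: proj_norm_ge0.
  apply/ler_addgt0Pr => e e0.
  pose d := Num.min 1 (e / (a + b + 1)).
  have ab0 : 0 < a + b + 1 by rewrite ltr_wpDl // addr_ge0.
  have d0 : 0 < d by rewrite lt_min ltr01 divr_gt0.
  have d1 : d <= 1 by rewrite ge_min lexx.
  have de : d * (a + b + 1) <= e by rewrite -ler_pdivlMr // ge_min lexx orbT.
  apply: le_trans (H (a + d) (b + d) _ _) _; rewrite ?ltrDl //.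
  nra.
move=> ux vy.
have [s us Hs] : exists2 s, u = tens_sum s & cost s < x.
  rewrite -subr_gt0 in ux; have [s us Hs] := proj_norm_approx u ux.
  by exists s; rewrite // addrC subrK in Hs *.
have [t vt Ht] : exists2 t, v = tens_sum t & cost t < y.
  rewrite -subr_gt0 in vy; have [t vt Ht] := proj_norm_approx v vy.
  by exists t; rewrite // addrC subrK in Ht *.
rewrite us vt tmul_sum (le_trans (proj_norm_le _)) // (le_trans (cost_tmul _ _)) //.
by rewrite ler_pM ?cost_ge0 // ltW.
Qed.

End AlgebraicTensorProduct.

(* A submultiplicative associative bilinear product extends to the completion. *)
Section CompletionProduct.
Variables (R : realType) (V : lmodType R[i]) (p : seminorm V).
Variable mul : V -> V -> V.
Hypothesis mulA : associative mul.
Hypothesis mulDl : left_distributive mul +%R.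
Hypothesis mulDr : right_distributive mul +%R.
Hypothesis mulZl : forall k x y, mul (k *: x) y = k *: mul x y.
Hypothesis mulZr : forall k x y, mul x (k *: y) = k *: mul x y.
Hypothesis mul_le : forall x y, p (mul x y) <= p x * p y.
Local Notation CS := (cauchySeq p).
Local Notation q := (lim_seminorm p).
Implicit Types u v w : CS.

Lemma cauchySeq_bounded u : exists2 M, 0 < M & forall n, p (u n) <= M.
Proof.
have [N HN] := cauchySeqP u ltr01.
exists (p (u N) + 1 + \sum_(i < N) p (u i)).
  by rewrite ltr_wpDr ?sumr_ge0 ?ltr_wpDl ?sn_ge0 // => i _; exact: sn_ge0.
move=> n; have [nN|Nn] := ltnP n N.
  rewrite (bigD1 (Ordinal nN)) //= addrCA lerDl addr_ge0 ?sumr_ge0 //.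
    by rewrite addr_ge0 ?sn_ge0.
  by move=> i _; exact: sn_ge0.
apply: (@le_trans _ _ (p (u N) + 1)); last first.
  by rewrite lerDl sumr_ge0 // => i _; exact: sn_ge0.
have := snD p (u n - u N) (u N); rewrite subrK => /le_trans; apply.
by rewrite addrC lerD2l ltW // HN.
Qed.

Lemma mul_sub x y x' y' :
  mul x y - mul x' y' = mul (x - x') y + mul x' (y - y').
Proof.
rewrite mulDl mulDr -(scaleN1r x') -(scaleN1r y') mulZl mulZr !scaleN1r.
by rewrite addrA subrK.
Qed.

Lemma cauchy_mul u v : cauchy_seq p (fun n => mul (u n) (v n)).
Proof.
apply/asboolP => e e0.
have [M M0 HM] := cauchySeq_bounded u; have [L L0 HL] := cauchySeq_bounded v.
have [N1 H1] := cauchySeqP u (divr_gt0 (divr_gt0 e0 (ltr0Sn R 1)) L0).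
have [N2 H2] := cauchySeqP v (divr_gt0 (divr_gt0 e0 (ltr0Sn R 1)) M0).
exists (maxn N1 N2) => m n; rewrite !geq_max => /andP[m1 m2] /andP[n1 n2].
rewrite mul_sub (le_lt_trans (snD _ _ _)) // [ltRHS]splitr ltrD //.
  apply: le_lt_trans (mul_le _ _) _.
  apply: (@le_lt_trans _ _ (p (u m - u n) * L)); first by rewrite ler_wpM2l ?sn_ge0.
  by rewrite -ltr_pdivlMr // H1.
apply: le_lt_trans (mul_le _ _) _.
apply: (@le_lt_trans _ _ (M * p (v m - v n))); first by rewrite ler_wpM2r ?sn_ge0.
by rewrite mulrC -ltr_pdivlMr // H2.
Qed.

Definition csmul u v : CS := CauchySeq (cauchy_mul u v).

Lemma csmul_le u v : q (csmul u v) <= q u * q v.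
Proof.
have := @ler_cvg_to _ \oo _ R (fun n => p (csmul u v n)) (fun n => p (u n) * p (v n)).
apply; [exact: lim_snP | exact: cvgM (lim_snP u) (lim_snP v) |].
by apply: nearW => n; exact: mul_le.
Qed.

Lemma csmul_sub u v u' v' :
  csmul u v - csmul u' v' = csmul (u - u') v + csmul u' (v - v').
Proof. by apply: val_inj; apply/funext => n; exact: mul_sub. Qed.

Definition cmul (x y : completion p) : completion p := cls (csmul (rep x) (rep y)).

Lemma cls_mul u v : cmul (cls u) (cls v) = cls (csmul u v).
Proof.
apply/clsP/eqP; rewrite eq_le sn_ge0 andbT csmul_sub (le_trans (snD q _ _)) //.
have := csmul_le (rep (cls u) - u) (rep (cls v)); rewrite rep_cls mul0r => H1.
have := csmul_le u (rep (cls v) - v); rewrite rep_cls mulr0 => H2.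
by rewrite -[leRHS]addr0 lerD.
Qed.

Lemma cmulA : associative cmul.
Proof.
elim/clsW => u; elim/clsW => v; elim/clsW => w; rewrite !cls_mul; congr cls.
by apply: val_inj; apply/funext => n; exact: mulA.
Qed.

Lemma cmulDl : left_distributive cmul +%R.
Proof.
elim/clsW => u; elim/clsW => v; elim/clsW => w.
rewrite -clsD !cls_mul -clsD; congr cls.
by apply: val_inj; apply/funext => n; exact: mulDl.
Qed.

Lemma cmulDr : right_distributive cmul +%R.
Proof.
elim/clsW => u; elim/clsW => v; elim/clsW => w.
rewrite -clsD !cls_mul -clsD; congr cls.
by apply: val_inj; apply/funext => n; exact: mulDr.
Qed.

Lemma cmulZl k x y : cmul (k *: x) y = k *: cmul x y.
Proof.
elim/clsW: x => u; elim/clsW: y => v; rewrite -clsZ !cls_mul -clsZ; congr cls.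
by apply: val_inj; apply/funext => n; exact: mulZl.
Qed.

Lemma cmulZr k x y : cmul x (k *: y) = k *: cmul x y.
Proof.
elim/clsW: x => u; elim/clsW: y => v; rewrite -clsZ !cls_mul -clsZ; congr cls.
by apply: val_inj; apply/funext => n; exact: mulZr.
Qed.

Lemma cnormM x y : `|cmul x y| <= `|x| * `|y|.
Proof.
elim/clsW: x => u; elim/clsW: y => v; rewrite cls_mul -!nrmE -rmorphM lecR.
by rewrite !nrm_cls csmul_le.
Qed.

Lemma cmul_cemb x y : cmul (cemb p x) (cemb p y) = cemb p (mul x y).
Proof. by rewrite cls_mul; congr cls; apply: val_inj. Qed.

End CompletionProduct.

Section ProjectiveTensor.
Variables (R : realType) (A B : banachAlgType R[i]).

(* The projective tensor product: the completion of the algebraic tensor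
   product in the projective norm. *)
Definition proj_tensor : Type := completion (proj_seminorm A B).
HB.instance Definition _ := CompleteNormedModule.on proj_tensor.

Definition ptmul : proj_tensor -> proj_tensor -> proj_tensor :=
  cmul (@tmulDl _ A B) (@tmulDr _ A B) (@tmulZl _ A B) (@tmulZr _ A B)
       (@proj_normM _ A B : forall x y, proj_seminorm A B _ <= _).

Lemma ptmulA : associative ptmul.
Proof. by apply: cmulA; exact: tmulA. Qed.

HB.instance Definition _ := isBanachAlgebra.Build R[i] proj_tensor
  ptmulA
  (cmulDl _ _ _ _ _) (cmulDr _ _ _ _ _) (cmulZl _ _ _ _ _) (cmulZr _ _ _ _ _)
  (cnormM _ _ _ _ _).

Local Open Scope banach_scope.

Definition tensor (a : A) (b : B) : proj_tensor :=
  cemb (proj_seminorm A B) (tens_sum [:: (a, b)]).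

Local Notation "a *t b" := (tensor a b) (at level 40).

Lemma tensorDl (a a' : A) (b : B) : (a + a') *t b = a *t b + a' *t b.
Proof.
rewrite -cembD -tens_sum_cat; congr cemb; apply: val_inj; apply/funext => phi.
by rewrite /= /tens_eval !big_cons !big_nil /= linearDl !addr0.
Qed.

Lemma tensorDr (a : A) (b b' : B) : a *t (b + b') = a *t b + a *t b'.
Proof.
rewrite -cembD -tens_sum_cat; congr cemb; apply: val_inj; apply/funext => phi.
by rewrite /= /tens_eval !big_cons !big_nil /= linearDr !addr0.
Qed.

Lemma tensorZl k (a : A) (b : B) : (k *: a) *t b = k *: (a *t b).
Proof. by rewrite -cembZ -tens_sum_scale. Qed.

Lemma tensorZr k (a : A) (b : B) : a *t (k *: b) = k *: (a *t b).
Proof.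
rewrite -cembZ -tens_sum_scale; congr cemb; apply: val_inj; apply/funext => phi.
by rewrite /= /tens_eval !big_cons !big_nil /= linearZl_LR linearZr_LR.
Qed.

Lemma sum_tensorE (s : seq (A * B)) :
  \sum_(ab <- s) ab.1 *t ab.2 = cemb (proj_seminorm A B) (tens_sum s).
Proof.
elim: s => [|[a b] s IH]; last first.
  by rewrite big_cons IH /tensor -cembD -tens_sum_cat.
have -> : tens_sum [::] = 0 *: (0 : algTensor A B).
  by rewrite scale0r; apply: val_inj; apply/funext => phi; rewrite /= /tens_eval big_nil.
by rewrite big_nil cembZ scale0r.
Qed.

Lemma nrm_sum_tensor (s : seq (A * B)) :
  nrm (\sum_(ab <- s) ab.1 *t ab.2) = proj_norm (tens_sum s).
Proof. by rewrite sum_tensorE nrm_cemb. Qed.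

Lemma tensor_dense (x : proj_tensor) (e : R) : 0 < e ->
  exists s : seq (A * B), nrm (x - \sum_(ab <- s) ab.1 *t ab.2) <= e.
Proof.
move=> e0; have [u xu] := cemb_dense x e0; have [s us] := algTensorP u.
by exists s; rewrite sum_tensorE -us.
Qed.

Lemma tensorM (a c : A) (b d : B) :
  (a *t b) ** (c *t d) = (a ** c) *t (b ** d).
Proof. by rewrite /bmul /= /ptmul cmul_cemb tmul_sum. Qed.

End ProjectiveTensor.

Section DualBimodule.
Variables (R : realType) (A : banachAlgType R[i]).
Implicit Types (a b x : A) (f : dual A).

Lemma lact_subproof a f : bounded_functional (fun x => f (x ** a)).
Proof.
apply/asboolP; split=> [k x y|]; first by rewrite bmulDl bmulZl dual_scalar.
exists (nrm f * nrm a) => x; apply: le_trans (dual_rnormP f _) _.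
by rewrite -mulrA ler_wpM2l ?dual_rnorm_ge0 // mulrC nrmM_le.
Qed.

Lemma ract_subproof f a : bounded_functional (fun x => f (a ** x)).
Proof.
apply/asboolP; split=> [k x y|]; first by rewrite bmulDr bmulZr dual_scalar.
exists (nrm f * nrm a) => x; apply: le_trans (dual_rnormP f _) _.
by rewrite -mulrA ler_wpM2l ?dual_rnorm_ge0 // nrmM_le.
Qed.

(* <a.f, x> = <f, xa> and <f.a, x> = <f, ax>. *)
Definition lact a f : dual A := Dual (lact_subproof a f).
Definition ract f a : dual A := Dual (ract_subproof f a).

Definition derivation (D : A -> dual A) : Prop :=
  [/\ linear D,
      exists M : R, forall a, nrm (D a) <= M * nrm a &
      forall a b, D (a ** b) = ract (D a) b + lact a (D b)].

Definition cyclic_map (D : A -> dual A) : Prop := forall a b, D a b + D b a = 0.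

End DualBimodule.

Definition directed (I : Type) (le : I -> I -> Prop) : Prop :=
  [/\ inhabited I, forall i, le i i,
      forall i j k, le i j -> le j k -> le i k &
      forall i j, exists k, le i k /\ le j k].

(* The filter of a net indexed by (I, le). *)
Definition tails (I : Type) (le : I -> I -> Prop) : set_system I :=
  [set P | exists i0, forall i, le i0 i -> P i].

Definition approximately_inner (R : realType) (A : banachAlgType R[i])
    (D : A -> dual A) : Prop :=
  exists (I : Type) (le : I -> I -> Prop) (x : I -> dual A),
    directed le /\
    forall a : A, (lact a (x i) - ract (x i) a) @[i --> tails le] --> D a.

Definition approx_cyclic_amenable (R : realType) (A : banachAlgType R[i]) : Prop :=
  forall D : A -> dual A, derivation D -> cyclic_map D -> approximately_inner D.

Definition character_space (R : realType) (A : banachAlgType R[i]) :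
    set (A -> R[i]) :=
  [set phi | [/\ scalar phi, forall a b, phi (a ** b) = phi a * phi b &
                 exists a, phi a != 0]].

Definition commutative_algebra (R : realType) (A : banachAlgType R[i]) : Prop :=
  commutative (@bmul R[i] A).

Arguments character_space {R} A.

(* Main.v *)
Require Import Defs.
From HB Require Import structures.
From mathcomp Require Import all_boot all_order all_algebra.
From mathcomp Require Import complex ring lra.
From mathcomp Require Import all_classical all_reals.
From mathcomp Require Import topology normedtype sequences.

Set Implicit Arguments.
Unset Strict Implicit.
Unset Printing Implicit Defensive.

Import Order.TTheory GRing.Theory Num.Theory.
Import numFieldNormedType.Exports.

Local Open Scope classical_set_scope.
Local Open Scope ring_scope.
Local Open Scope complex_scope.

(** Fix a character psi of B and a cyclic derivation D of A. Since psi is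
    multiplicative, the bilinear form (b, d) |-> psi b * psi d depends only on
    the product bd, so multiplying it with (a, c) |-> <D a, c> gives a bounded
    cyclic derivation F of the projective tensor product T of A and B, with
      <F (a (x) b), c (x) d> = <D a, c> psi b psi d
    ([tensor_dual_map], [character_square]). If T is approximately cyclic
    amenable, F is a limit of inner derivations u |-> u.x_i - x_i.u. Pick b0
    with psi b0 = 1 and test on a (x) b0 and c (x) b0:
      <D a, c> = lim <x_i, (ca) (x) b0^2 - (ac) (x) b0^2>,
    uniformly for c in the unit ball. So the functionals
    y_i := x_i (- (x) b0^2) on A make D approximately inner
    ([approximately_inner_descends]), although a |-> a (x) b0 is not a
    homomorphism. Exchanging the factors gives the statement for B, and (ii) is
    (i) with both factors equal to A.

    Two analytic facts are needed. Characters are automatically bounded, because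
    b with norm less than 1 has a quasi-inverse ([quasi_inverse],
    [character_bounded]). And F is not obtained from a map of T into A: it is
    built by extending scalar bilinear forms to T, once in each variable
    ([bilinear_form_extends]), after which every identity about F is checked on
    elementary tensors, where bounded functionals are determined
    ([dual_tensor_ext]). *)

(** * Limits in the complex numbers and in Banach spaces *)

Section Limits.
Variable R : realType.

Lemma scalar_map0 (V : lmodType R[i]) (f : V -> R[i]) : scalar f -> f 0 = 0.
Proof.
by move=> fl; have := fl (-1) 0 0; rewrite scaler0 addr0 mulN1r addNr.
Qed.

(** The shape in which the bound M of a linear map enters an epsilon argument:
    M may vanish, so one divides by M + 1. *)
Lemma ler_pM_divD1 (M e : R) : 0 <= M -> 0 < e -> M * (e / (M + 1)) <= e.
Proof.
move=> M0 e0; have M1 : 0 < M + 1 by rewrite ltr_wpDl.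
by rewrite mulrCA ger_pMr // ler_pdivrMr // mul1r lerDl.
Qed.

Lemma nrm_i : nrm ('i%C : R[i]) = 1.
Proof. by rewrite /nrm normc_def /= expr0n expr1n add0r sqrtr1. Qed.

Lemma nrm_Re (z : R[i]) : `|complex.Re z| <= nrm z.
Proof. by rewrite -lecR nrmE normc_ge_Re. Qed.

Lemma nrm_Im (z : R[i]) : `|complex.Im z| <= nrm z.
Proof.
by have := nrm_Re (z * 'i%C); rewrite ReiNIm normrN nrmM nrm_i mulr1.
Qed.

Lemma nrm_le_ReIm (z : R[i]) : nrm z <= `|complex.Re z| + `|complex.Im z|.
Proof.
rewrite {1}(complexE z) (le_trans (nrmD _ _)) // nrmM.
have nr (r : R) : nrm r%:C = `|r|.
  by apply: (@complexI R); rewrite nrmE normc_def /= expr0n addr0 sqrtr_sqr.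
by rewrite !nr nrm_i mul1r.
Qed.

Lemma real_cauchy_limit (u : nat -> R) :
  (forall e : R, 0 < e ->
     exists N, forall m n, (N <= m)%N -> (N <= n)%N -> `|u m - u n| < e) ->
  exists l, forall e : R, 0 < e -> exists N, forall n, (N <= n)%N -> `|u n - l| < e.
Proof.
move=> Hu; have : cvgn u.
  apply: R_complete; apply/cauchy_ballP => e e0; near_simpl.
  have [N H] := Hu e e0.
  exists ([set n | (N <= n)%N], [set n | (N <= n)%N]) => /=.
    by split; exists N.
  by case=> m n /= [Nm Nn]; rewrite /ball /=; exact: H.
move=> /cvg_ex[l /cvgrPdist_lt ul]; exists l => e /ul[N _ HN]; exists N => n Nn.
by rewrite distrC; exact: HN.
Qed.

Lemma complex_cauchy_limit (z : nat -> R[i]) :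
  (forall e : R, 0 < e ->
     exists N, forall m n, (N <= m)%N -> (N <= n)%N -> nrm (z m - z n) < e) ->
  exists l, forall e : R, 0 < e ->
    exists N, forall n, (N <= n)%N -> nrm (z n - l) < e.
Proof.
move=> Hz.
have [|x Hx] := @real_cauchy_limit (fun n => complex.Re (z n)).
  move=> e /Hz[N HN]; exists N => m n Nm Nn.
  by rewrite -raddfB (le_lt_trans (nrm_Re _)) ?HN.
have [|y Hy] := @real_cauchy_limit (fun n => complex.Im (z n)).
  move=> e /Hz[N HN]; exists N => m n Nm Nn.
  by rewrite -raddfB (le_lt_trans (nrm_Im _)) ?HN.
exists (x +i* y) => e e0; have e20 : 0 < e / 2 by rewrite divr_gt0.
have [N1 H1] := Hx _ e20; have [N2 H2] := Hy _ e20.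
exists (maxn N1 N2) => n; rewrite geq_max => /andP[n1 n2].
rewrite (le_lt_trans (nrm_le_ReIm _)) // !raddfB /= [ltRHS]splitr.
by rewrite ltrD ?H1 ?H2.
Qed.

(** Absolutely convergent series converge. The norm of V takes its values in
    R[i], which is why the real series is compared with it by hand. *)
Lemma cvg_series_nrm (V : completeNormedModType R[i]) (u : nat -> V) :
  cvgn (series (fun n => nrm (u n))) -> cvgn (series u).
Proof.
move=> /cauchy_cvgP/cauchy_seriesP Hu; apply/cauchy_cvgP/cauchy_seriesP => E E0.
have Ee : E = (complex.Re E)%:C by rewrite RRe_real // ger0_real // ltW.
have e0 : 0 < complex.Re E by rewrite -ltcR -Ee.
apply: filterS (Hu _ e0) => -[m n] /=; rewrite Ee -nrmE ltcR.
apply: le_lt_trans; rewrite (le_trans (nrm_sum _ _)) // ger0_norm //.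
by apply: sumr_ge0 => i _; exact: nrm_ge0.
Qed.

End Limits.

(** * Automatic continuity of characters *)

Section Characters.
Variables (R : realType) (A : banachAlgType R[i]).
Local Open Scope banach_scope.

(** The Neumann series b + b^2 + b^3 + ...; no unit is available, so the usual
    inverse of 1 - b is replaced by s with (1 - b)(1 + s) = 1 formally. *)
Lemma quasi_inverse (b : A) : nrm b < 1 -> exists s, s = b + b ** s.
Proof.
move=> b1; pose u n := iter n (bmul b) b.
have nu n : nrm (u n) <= geometric (nrm b) (nrm b) n.
  elim: n => [|n IH]; first by rewrite /= expr0 mulr1.
  rewrite /= exprS mulrCA (le_trans (nrmM_le _ _)) // ler_wpM2l //.
  exact: nrm_ge0.
have : cvgn (series u).
  apply: cvg_series_nrm.
  apply: (@series_le_cvg _ _ (geometric (nrm b) (nrm b))) => //.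
  - by move=> n; exact: nrm_ge0.
  - by move=> n; exact: le_trans (nrm_ge0 _) (nu n).
  - by apply: is_cvg_geometric_series; rewrite ger0_norm ?nrm_ge0.
have seriesS n : series u n.+1 = b + b ** series u n.
  elim: n => [|n IH].
    by rewrite /series /= big_nat1 big_geq // bmul0r addr0.
  by rewrite seriesSr {1}IH -addrA -bmulDr -seriesSr.
move=> /cvg_ex[s /cvgrPdist_lt us]; exists s; apply/eqP; rewrite -subr_eq0.
apply/eqP/nrm0_eq0/eqP; rewrite eq_le nrm_ge0 andbT.
apply/ler_addgt0Pr => e e0; rewrite add0r.
have e20 : 0 < e / 2 by rewrite divr_gt0.
have E0 : 0 < (e / 2)%:C by rewrite ltcR.
have [N _ HN] := us _ E0.
have near_s n : (N <= n)%N -> nrm (s - series u n) <= e / 2.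
  by move=> Nn; rewrite ltW // -ltcR nrmE; exact: HN.
have -> : s - (b + b ** s) = (s - series u N.+1) + b ** (series u N - s).
  by rewrite seriesS bmulDr -(scaleN1r s) bmulZr scaleN1r !opprD !addrA subrK.
rewrite (le_trans (nrmD _ _)) // [leRHS]splitr lerD ?near_s //.
rewrite (le_trans (nrmM_le _ _)) // -[leRHS]mul1r ler_pM ?nrm_ge0 ?(ltW b1) //.
by rewrite -nrmN opprB near_s.
Qed.

(** If |psi b| > |b|, rescale to psi c = 1 with |c| < 1; then s = c + cs gives
    psi s = 1 + psi s. *)
Lemma character_bounded (psi : A -> R[i]) : character_space A psi ->
  forall b, nrm (psi b) <= nrm b.
Proof.
move=> [psi_lin psiM _] b; rewrite leNgt; apply/negP => lt_b.
have psi0 := scalar_map0 psi_lin.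
have psiD x y : psi (x + y) = psi x + psi y.
  by have := psi_lin 1 x y; rewrite scale1r mul1r.
have psiZ k x : psi (k *: x) = k * psi x.
  by have := psi_lin k x 0; rewrite !addr0 psi0 addr0.
have p0 : 0 < nrm (psi b) by exact: le_lt_trans (nrm_ge0 _) lt_b.
have pb0 : psi b != 0 by apply: contraTneq p0 => ->; rewrite nrm0 ltxx.
have [|s Hs] := @quasi_inverse ((psi b)^-1 *: b).
  rewrite -(ltr_pM2l p0) nrmZ mulrA -nrmM divff // mulr1.
  by rewrite /nrm normr1 /= mul1r.
have := congr1 psi Hs; rewrite psiD psiM psiZ mulVf // mul1r => /eqP.
by rewrite addrC -subr_eq0 opprD addrA subrr sub0r oppr_eq0 oner_eq0.
Qed.

Lemma character_normalized (psi : A -> R[i]) :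
  character_space A psi -> exists a, psi a = 1.
Proof.
move=> [lin _ [a pa]]; exists ((psi a)^-1 *: a).
have psi0 := scalar_map0 lin.
by rewrite -[_ *: a]addr0 lin psi0 addr0 /GRing.scale /= mulVf.
Qed.

(** As psi b * psi d = psi (bd), this form is symmetric and invariant, which is
    why multiplying it with a cyclic derivation gives a cyclic derivation. *)
Lemma character_square (psi : A -> R[i]) :
  character_space A psi ->
  exists E : A -> dual A,
    [/\ linear E, forall b, nrm (E b) <= 1 * nrm b &
        forall b d, E b d = psi b * psi d].
Proof.
move=> ch; have pb := character_bounded ch; case: (ch) => lin _ _.
have psiP : bounded_functional psi.
  by apply/asboolP; split => //; exists 1 => x; rewrite mul1r.
exists (fun b => psi b *: Dual psiP); split=> //.
  by move=> k x y; apply: dual_eq => d; rewrite dualD !dualZ lin /=; ring.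
move=> b; rewrite nrmZ mul1r -[leRHS]mulr1 ler_pM ?nrm_ge0 //.
by apply: dual_rnorm_le => // d; rewrite mul1r.
Qed.

End Characters.

(** * Functionals and forms on the projective tensor product *)

Section Extension.
Variable R : realType.

(** The value at x is the number k characterised by
    |k - F v| <= M |x - v| for all v in V; it exists because F maps a sequence
    tending to x to a Cauchy sequence, and linearity follows from the
    characterisation by density. *)
Lemma functional_extends_to_completion (V : lmodType R[i]) (p : seminorm V)
    (F : V -> R[i]) (M : R) :
  scalar F -> 0 <= M -> (forall v, nrm (F v) <= M * p v) ->
  exists G : dual (completion p),
    (forall v, G (cemb p v) = F v) /\ forall x, nrm (G x) <= M * nrm x.
Proof.
move=> Flin M0 FM.
have F0 := scalar_map0 Flin.
have FB x y : F (x - y) = F x - F y.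
  by rewrite addrC -scaleN1r Flin mulN1r addrC.
have M1 : 0 < M + 1 by rewrite ltr_wpDl.
have FMe v w e : nrm (cemb p v - cemb p w) <= e -> nrm (F v - F w) <= M * e.
  rewrite -FB -cembN -cembD nrm_cemb => vw.
  by rewrite (le_trans (FM _)) // ler_wpM2l.
have ex x : exists k, forall v, nrm (k - F v) <= M * nrm (x - cemb p v).
  have inv0 n : 0 < n.+1%:R^-1 :> R by rewrite invr_gt0.
  have [v Hv] := choice (fun n => cemb_dense x (inv0 n)).
  have small e : 0 < e ->
      exists N, forall n, (N <= n)%N -> nrm (x - cemb p (v n)) <= e.
    move=> /small_inv[N HN]; exists N => n Nn.
    rewrite (le_trans (Hv n)) // (le_trans _ (ltW HN)) //.
    by rewrite lef_pV2 ?posrE // ler_nat ltnS.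
  have [|k Hk] := @complex_cauchy_limit R (fun n => F (v n)).
    move=> e e0; have e3 : 0 < e / 2 / (M + 1) by rewrite !divr_gt0.
    have [N HN] := small _ e3; exists N => m n Nm Nn.
    apply: (@le_lt_trans _ _ (M * (e / (M + 1)))).
      apply: FMe; rewrite -(subrK x (cemb p (v m))) -addrA.
      rewrite (le_trans (nrmD _ _)) //.
      have -> : e / (M + 1) = e / 2 / (M + 1) + e / 2 / (M + 1).
        by rewrite -mulrDl -splitr.
      by rewrite lerD ?HN // -nrmN opprB HN.
    by rewrite mulrCA gtr_pMr // ltr_pdivrMr // mul1r ltrDl.
  exists k => w; apply/ler_addgt0Pr => e e0.
  have e3 : 0 < e / 2 / (M + 1) by rewrite !divr_gt0.
  have e2 : 0 < e / 2 by rewrite divr_gt0.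
  have [N1 H1] := small _ e3; have [N2 H2] := Hk _ e2.
  pose n := maxn N1 N2.
  have {}H1 : nrm (x - cemb p (v n)) <= e / 2 / (M + 1) by apply/H1/leq_maxl.
  have {}H2 : nrm (F (v n) - k) < e / 2 by apply/H2/leq_maxr.
  have H3 : nrm (F (v n) - F w) <= M * (nrm (x - cemb p w) + e / 2 / (M + 1)).
    apply: FMe; rewrite -(subrK x (cemb p (v n))) -addrA.
    by rewrite (le_trans (nrmD _ _)) // [leRHS]addrC lerD2r -nrmN opprB.
  have H4 := ler_pM_divD1 M0 e2.
  rewrite -(subrK (F (v n)) k) -addrA (le_trans (nrmD _ _)) //.
  rewrite -nrmN opprB; lra.
have [G HG] := choice ex.
have Gb x : nrm (G x) <= M * nrm x.
  have c0 : cemb p 0 = 0 by rewrite -(scale0r (0 : V)) cembZ scale0r.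
  by have := HG x 0; rewrite F0 c0 !subr0.
have Glin : scalar G.
  move=> a x y; apply/eqP; rewrite -subr_eq0; apply/eqP/nrm0_eq0/eqP.
  rewrite eq_le nrm_ge0 andbT; apply/ler_addgt0Pr => e e0; rewrite add0r.
  (* If x and y are moved by at most d, then G (a x + y) and a G x + G y
     each change by at most M (|a| + 1) d. *)
  pose K := 2 * (M + 1) * (nrm a + 1).
  have a0 := nrm_ge0 a.
  have K0 : 0 < K by rewrite !mulr_gt0 // ltr_wpDl.
  have [v xv] := cemb_dense x (divr_gt0 e0 K0).
  have [w yw] := cemb_dense y (divr_gt0 e0 K0).
  have d0 : 0 < e / K by rewrite divr_gt0.
  have Kd : K * (e / K) = e by rewrite mulrC divfK // lt0r_neq0.
  move: (e / K) d0 Kd xv yw => d d0 Kd xv yw.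
  have H1 := HG (a *: x + y) (a *: v + w).
  have H2 : nrm (G x - F v) <= M * d by rewrite (le_trans (HG _ _)) // ler_wpM2l.
  have H3 : nrm (G y - F w) <= M * d by rewrite (le_trans (HG _ _)) // ler_wpM2l.
  have H4 : nrm (a *: x + y - cemb p (a *: v + w)) <= nrm a * d + d.
    rewrite cembD cembZ opprD addrACA -scalerBr (le_trans (nrmD _ _)) //.
    by rewrite nrmZ lerD // ler_wpM2l.
  have {}H1 : nrm (G (a *: x + y) - F (a *: v + w)) <= M * (nrm a * d + d).
    by rewrite (le_trans H1) // ler_wpM2l.
  have -> : G (a *: x + y) - (a * G x + G y) =
     (G (a *: x + y) - F (a *: v + w)) - (a * (G x - F v) + (G y - F w)).
    by rewrite Flin /GRing.scale /=; ring.
  rewrite (le_trans (nrmD _ _)) // nrmN.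
  have H5 : nrm (a * (G x - F v) + (G y - F w)) <= nrm a * (M * d) + M * d.
    by rewrite (le_trans (nrmD _ _)) // nrmM lerD // ler_wpM2l.
  rewrite -Kd /K; nra.
have Gd : bounded_functional G by apply/asboolP; split => //; exists M.
exists (Dual Gd); split => // v; apply/eqP; rewrite -subr_eq0.
apply/eqP/nrm0_eq0/eqP; rewrite eq_le nrm_ge0 andbT.
by rewrite (le_trans (HG _ v)) // subrr nrm0 mulr0.
Qed.

Section Tensor.
Variables A B : banachAlgType R[i].
Local Notation T := (proj_tensor A B).

Lemma nrm_tensor_le (a : A) (b : B) : nrm (tensor a b : T) <= nrm a * nrm b.
Proof.
by rewrite nrm_cemb (le_trans (proj_norm_le _)) // /cost big_seq1.
Qed.

Lemma dual_sum (V : normedModType R[i]) (f : dual V) I (s : seq I) (u : I -> V) :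
  f (\sum_(i <- s) u i) = \sum_(i <- s) f (u i).
Proof.
elim: s => [|i s IH]; first by rewrite !big_nil dual0.
by rewrite !big_cons dual_lD IH.
Qed.

(** Elementary tensors span a dense subspace. *)
Lemma dual_tensor_ext (f g : dual T) :
  (forall a b, f (tensor a b) = g (tensor a b)) -> f = g.
Proof.
move=> fg; apply/eqP; rewrite -subr_eq0; apply/eqP/dual_eq => x.
have d0 (s : seq (A * B)) : (f - g) (\sum_(ab <- s) tensor ab.1 ab.2) = 0.
  by rewrite dual_sum big1 // => ab _; rewrite /= fctE /= fg subrr.
apply/nrm0_eq0/eqP; rewrite eq_le nrm_ge0 andbT.
apply/ler_addgt0Pr => e e0; rewrite add0r.
have n1 : 0 < nrm (f - g) + 1 by rewrite ltr_wpDl // nrm_ge0.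
have [s xs] := tensor_dense x (divr_gt0 e0 n1).
rewrite -(subrK (\sum_(ab <- s) tensor ab.1 ab.2) x) dual_lD d0 addr0.
rewrite (le_trans (dual_rnormP _ _)) //.
rewrite (le_trans (ler_wpM2l (dual_rnorm_ge0 _) xs)) //.
exact: (ler_pM_divD1 (nrm_ge0 (f - g)) e0).
Qed.

(** The universal property of the projective norm, for scalar values: a tensor
    is by construction a functional on bilinear forms, so the extension is
    evaluation at f, bounded by M since this holds on every representation. *)
Lemma bilinear_form_extends (f : A -> B -> R[i]) (M : R) :
  bilinear_for *%R *%R f -> 0 <= M ->
  (forall a b, nrm (f a b) <= M * (nrm a * nrm b)) ->
  exists G : dual T,
    (forall a b, G (tensor a b) = f a b) /\ forall x, nrm (G x) <= M * nrm x.
Proof.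
move=> fbil M0 fM.
pose phi : bform A B :=
  HB.pack f (bilinear_isBilinear.Build R[i] A B R[i] *%R *%R f fbil).
have [||v|G [GE GM]] := @functional_extends_to_completion _ (proj_seminorm A B)
    (fun u => u phi) M; [by []|by []| |exists G; split => // a b].
  apply/ler_addgt0Pr => e e0.
  have M1 : 0 < M + 1 by rewrite ltr_wpDl.
  have [s vs Hs] := proj_norm_approx v (divr_gt0 e0 M1).
  rewrite vs /= /tens_eval (le_trans (nrm_sum _ _)) //.
  apply: (@le_trans _ _ (M * cost s)).
    by rewrite /cost big_distrr; apply: ler_sum => ab _; exact: fM.
  rewrite -vs (le_trans (ler_wpM2l M0 (ltW Hs))) // mulrDr lerD2l.
  exact: ler_pM_divD1.
by rewrite GE /= /tens_eval big_seq1.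
Qed.

(** The tensor product of the bilinear forms D and E. The universal property is
    used twice: for fixed c and d in the variables a and b, which gives
    functionals g (c, d), and then for fixed u in the variables c and d of
    g (c, d) u. *)
Lemma tensor_dual_map (D : A -> dual A) (E : B -> dual B) (M N : R) :
  linear D -> (forall a, nrm (D a) <= M * nrm a) ->
  linear E -> (forall b, nrm (E b) <= N * nrm b) ->
  exists F : T -> dual T,
    [/\ linear F, exists K, forall u, nrm (F u) <= K * nrm u &
        forall a b c d, F (tensor a b) (tensor c d) = D a c * E b d].
Proof.
wlog [M0 N0] : M N / 0 <= M /\ 0 <= N.
  move=> H Dl DM El EN; apply: (H (Num.max M 0) (Num.max N 0)) => //.
  - by rewrite !le_max lexx !orbT.
  - by move=> a; rewrite (le_trans (DM a)) // ler_wpM2r ?nrm_ge0 // le_max lexx.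
  - by move=> b; rewrite (le_trans (EN b)) // ler_wpM2r ?nrm_ge0 // le_max lexx.
move=> Dl DM El EN; have MN0 : 0 <= M * N by rewrite mulr_ge0.
have DE a b c d :
    nrm (D a c * E b d) <= M * N * (nrm c * nrm d) * (nrm a * nrm b).
  have Dac : nrm (D a c) <= M * nrm a * nrm c.
    by rewrite (le_trans (dual_rnormP _ _)) // ler_wpM2r ?nrm_ge0 // DM.
  have Ebd : nrm (E b d) <= N * nrm b * nrm d.
    by rewrite (le_trans (dual_rnormP _ _)) // ler_wpM2r ?nrm_ge0 // EN.
  rewrite nrmM (le_trans (ler_pM (nrm_ge0 _) (nrm_ge0 _) Dac Ebd)) //.
  by rewrite le_eqVlt; apply/orP; left; apply/eqP; ring.
have exg (cd : A * B) : exists G : dual T,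
    (forall a b, G (tensor a b) = D a cd.1 * E b cd.2) /\
    forall x, nrm (G x) <= M * N * (nrm cd.1 * nrm cd.2) * nrm x.
  apply: (@bilinear_form_extends (fun a b => D a cd.1 * E b cd.2)).
  - split=> [b k a a'|a k b b'] /=.
      by rewrite Dl dualD dualZ; ring.
    by rewrite El dualD dualZ; ring.
  - by rewrite !mulr_ge0 ?nrm_ge0.
  - by move=> a b; exact: DE.
have [g /all_and2[gE gM]] := choice exg.
have exh (u : T) : exists G : dual T,
    (forall c d, G (tensor c d) = g (c, d) u) /\
    forall x, nrm (G x) <= M * N * nrm u * nrm x.
  apply: (@bilinear_form_extends (fun c d => g (c, d) u)).
  - split=> [d k c c'|c k d d'] /=.
      suff -> : g (k *: c + c', d) = k *: g (c, d) + g (c', d) by [].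
      apply: dual_tensor_ext => a b; rewrite dualD dualZ !gE /=.
      by rewrite dual_lD dual_lZ; ring.
    suff -> : g (c, k *: d + d') = k *: g (c, d) + g (c, d') by [].
    apply: dual_tensor_ext => a b; rewrite dualD dualZ !gE /=.
    by rewrite dual_lD dual_lZ; ring.
  - by rewrite mulr_ge0 ?nrm_ge0.
  - move=> c d; rewrite (le_trans (gM _ _)) //=.
    by rewrite le_eqVlt; apply/orP; left; apply/eqP; ring.
have [F /all_and2[FE FM]] := choice exh.
exists F; split.
- move=> k u v; apply: dual_tensor_ext => c d.
  by rewrite dualD dualZ !FE dual_lD dual_lZ.
- exists (M * N) => u; apply: dual_rnorm_le => //.
  by rewrite mulr_ge0 ?nrm_ge0.
- by move=> a b c d; rewrite FE gE.
Qed.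

End Tensor.
End Extension.

(** * Cyclic derivations on the projective tensor product *)

Section CyclicDerivations.
Variable R : realType.
Local Open Scope banach_scope.

(** Makes [dual_tensor_ext] applicable to the first argument of F. *)
Lemma transpose_functional (V : normedModType R[i]) (F : V -> dual V) (K : R) :
  linear F -> (forall u, nrm (F u) <= K * nrm u) ->
  forall v, exists g : dual V, forall u, g u = F u v.
Proof.
move=> Fl FK v.
have gP : bounded_functional (fun u => F u v).
  apply/asboolP; split=> [k x y|]; first by rewrite Fl.
  exists (K * nrm v) => u; rewrite (le_trans (dual_rnormP _ _)) // mulrAC.
  by rewrite ler_wpM2r ?nrm_ge0 // FK.
by exists (Dual gP).
Qed.

(** Cyclicity turns the derivation rule into an identity that is invariant under
    rotation of (u, v, w), so that it can be verified in one variable at a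
    time. *)
Definition cyclic_cocycle (A : banachAlgType R[i]) (F : A -> dual A) : Prop :=
  forall u v w, F (u ** v) w + F (v ** w) u + F (w ** u) v = 0.

Lemma cyclic_cocycleP (A : banachAlgType R[i]) (F : A -> dual A) :
  cyclic_map F ->
  cyclic_cocycle F <->
  (forall u v, F (u ** v) = ract (F u) v + lact u (F v)).
Proof.
move=> Fc; split=> H.
  move=> u v; apply: dual_eq => w; rewrite dualD /=.
  have := H u v w; have := Fc (v ** w) u; have := Fc (w ** u) v.
  move=> /eqP; rewrite addr_eq0 => /eqP ->.
  move=> /eqP; rewrite addr_eq0 => /eqP ->.
  by move=> /eqP; rewrite -addrA -opprD subr_eq0 => /eqP.
move=> u v w; rewrite H dualD /=.
have /eqP := Fc (v ** w) u; rewrite addr_eq0 => /eqP ->.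
have /eqP := Fc (w ** u) v; rewrite addr_eq0 => /eqP ->.
by rewrite -addrA -opprD subrr.
Qed.

Section OnTensors.
Variables A B : banachAlgType R[i].
Local Notation T := (proj_tensor A B).
Variables (F : T -> dual T) (K : R).
Hypothesis Flin : linear F.
Hypothesis FK : forall u, nrm (F u) <= K * nrm u.

Lemma cyclic_map_tensor :
  (forall a b c d, F (tensor a b) (tensor c d) + F (tensor c d) (tensor a b) = 0) ->
  cyclic_map F.
Proof.
move=> H.
have step1 c d u : F u (tensor c d) = - F (tensor c d) u.
  have [g gE] := transpose_functional Flin FK (tensor c d).
  rewrite -gE; suff -> : g = - F (tensor c d) by [].
  apply: dual_tensor_ext => a b; rewrite gE.
  by apply/eqP; rewrite -addr_eq0; apply/eqP/H.
move=> u v; have [g gE] := transpose_functional Flin FK u.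
rewrite -gE; suff -> : F u = - g by exact: addNr.
by apply: dual_tensor_ext => c d; rewrite step1 -gE.
Qed.

(** Each of the three terms is a bounded functional of u, by cyclicity of F;
    hence u may be assumed elementary, and rotating the identity does the same
    for v and w. *)
Lemma cyclic_cocycle_tensor :
  cyclic_map F ->
  (forall a b c d e f,
     F (tensor a b ** tensor c d) (tensor e f)
     + F (tensor c d ** tensor e f) (tensor a b)
     + F (tensor e f ** tensor a b) (tensor c d) = 0) ->
  cyclic_cocycle F.
Proof.
move=> Fc H.
have swap x y : F x y = - F y x.
  by apply/eqP; rewrite -addr_eq0; apply/eqP/Fc.
have spread v w :
    (forall a b, F (tensor a b ** v) w + F (v ** w) (tensor a b)
                 + F (w ** tensor a b) v = 0) ->
    forall u, F (u ** v) w + F (v ** w) u + F (w ** u) v = 0.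
  move=> Hvw u; pose g : dual T := F (v ** w) - (lact v (F w) + ract (F v) w).
  have gE x : F (x ** v) w + F (v ** w) x + F (w ** x) v = g x.
    transitivity (F (v ** w) x - (F w (x ** v) + F v (w ** x))); last by [].
    by rewrite (swap (x ** v)) (swap (w ** x)); ring.
  rewrite gE; suff -> : g = 0 by [].
  by apply: dual_tensor_ext => a b; rewrite -gE Hvw.
have rot u v w : F (u ** v) w + F (v ** w) u + F (w ** u) v =
                 F (v ** w) u + F (w ** u) v + F (u ** v) w.
  by rewrite -addrA addrC.
move=> u v w; apply: (spread) => a b; rewrite rot.
apply: (spread) => c d; rewrite rot; apply: (spread) => e f; rewrite rot.
exact: H.
Qed.

End OnTensors.

(** * Descent to the factors *)

Lemma tails_filter (I : Type) (le : I -> I -> Prop) :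
  directed le -> Filter (tails le).
Proof.
move=> [[i0] _ tr up]; split.
- by exists i0.
- move=> P Q [i Pi] [j Qj]; have [k [ik jk]] := up i j.
  by exists k => l kl; split; [apply/Pi/(tr _ k) | apply/Qj/(tr _ k)].
- by move=> P Q PQ [i Pi]; exists i => j /Pi; exact: PQ.
Qed.

Lemma dual_comp_subproof (V W : normedModType R[i]) (s : V -> W)
    (K : R) (f : dual W) :
  linear s -> (forall x, nrm (s x) <= K * nrm x) ->
  bounded_functional (fun x => f (s x)).
Proof.
move=> sl sK; apply/asboolP; split=> [k x y|]; first by rewrite sl dual_scalar.
exists (nrm f * K) => x; rewrite (le_trans (dual_rnormP _ _)) // -mulrA.
by rewrite ler_wpM2l ?dual_rnorm_ge0.
Qed.

(** In the application j and s are a |-> a (x) b0 and a |-> a (x) b0^2. The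
    implementing net of F is pulled back along s rather than j, since the inner
    derivations see only the products j c ** j a = s (c ** a). Boundedness of j
    makes the convergence uniform on the unit ball of A. *)
Lemma approximately_inner_descends (A T : banachAlgType R[i])
    (D : A -> dual A) (F : T -> dual T) (j s : A -> T) (J S : R) :
  (forall x, nrm (j x) <= J * nrm x) ->
  linear s -> (forall x, nrm (s x) <= S * nrm x) ->
  (forall a c, j c ** j a = s (c ** a)) ->
  (forall a c, F (j a) (j c) = D a c) ->
  approximately_inner F -> approximately_inner D.
Proof.
move=> jJ sl sS js FD [I [le [x [dir xF]]]].
exists I, le, (fun i => Dual (dual_comp_subproof (x i) sl sS)); split=> // a.
have FT := tails_filter dir.
apply/cvgrPdist_le => E E0.
have Ee : E = (complex.Re E)%:C by rewrite RRe_real // ger0_real // ltW.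
have e0 : 0 < complex.Re E by rewrite -ltcR -Ee.
move: (complex.Re E) Ee e0 => e -> e0.
have J1 : 0 < `|J| + 1 by rewrite ltr_wpDl.
have E1 : 0 < (e / (`|J| + 1))%:C by rewrite ltcR divr_gt0.
move/cvgrPdist_le: (xF (j a)) => /(_ _ E1); apply: filterS => i.
rewrite -!nrmE !lecR => xi.
apply: dual_rnorm_le; first exact: ltW.
move=> c.
set f := F (j a) - _ in xi.
have -> : (D a - (lact a (Dual (dual_comp_subproof (x i) sl sS)) -
    ract (Dual (dual_comp_subproof (x i) sl sS)) a)) c = f (j c).
  transitivity (D a c - (x i (s (c ** a)) - x i (s (a ** c)))); first by [].
  by rewrite -!js -FD.
rewrite (le_trans (dual_rnormP _ _)) //.
apply: (@le_trans _ _ (e / (`|J| + 1) * ((`|J| + 1) * nrm c))); last first.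
  by rewrite mulrA divfK // lt0r_neq0.
apply: ler_pM => //; [exact: dual_rnorm_ge0 | exact: nrm_ge0 |].
rewrite (le_trans (jJ c)) // ler_wpM2r ?nrm_ge0 //.
by rewrite (le_trans (ler_norm J)) // lerDl.
Qed.

Section Amenability.
Variables A B : banachAlgType R[i].
Local Notation T := (proj_tensor A B).

Lemma approx_cyclic_amenable_left :
  character_space B !=set0 -> approx_cyclic_amenable T ->
  approx_cyclic_amenable A.
Proof.
move=> [psi ch] ET D [Dl [M DM] Dder] Dc.
have [E [El EN EE]] := character_square ch.
have [F [Fl [K FK] FE]] := tensor_dual_map Dl DM El EN.
have Dcc := (cyclic_cocycleP Dc).2 Dder.
case: (ch) => _ psiM _.
have Fc : cyclic_map F.
  apply: (cyclic_map_tensor Fl FK) => a b c d; rewrite !FE !EE.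
  by rewrite (mulrC (psi d)) -mulrDl Dc mul0r.
have Fcc : cyclic_cocycle F.
  apply: (cyclic_cocycle_tensor Fc) => a b c d e f.
  rewrite !tensorM !FE !EE !psiM.
  transitivity ((D (a ** c) e + D (c ** e) a + D (e ** a) c)
                * (psi b * psi d * psi f)); first by ring.
  by rewrite Dcc mul0r.
have Fder : derivation F by split=> //; [exists K | exact/cyclic_cocycleP].
have [b0 pb0] := character_normalized ch.
apply: (@approximately_inner_descends A T D F (fun a => tensor a b0)
  (fun a => tensor a (b0 ** b0)) (nrm b0) (nrm (b0 ** b0))) (ET F Fder Fc).
- by move=> a; rewrite mulrC nrm_tensor_le.
- by move=> k x y; rewrite tensorDl tensorZl.
- by move=> a; rewrite mulrC nrm_tensor_le.
- by move=> a c; rewrite tensorM.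
- by move=> a c; rewrite FE EE pb0 !mulr1.
Qed.

Lemma approx_cyclic_amenable_right :
  character_space A !=set0 -> approx_cyclic_amenable T ->
  approx_cyclic_amenable B.
Proof.
move=> [psi ch] ET D [Dl [M DM] Dder] Dc.
have [E [El EN EE]] := character_square ch.
have [F [Fl [K FK] FE]] := tensor_dual_map El EN Dl DM.
have Dcc := (cyclic_cocycleP Dc).2 Dder.
case: (ch) => _ psiM _.
have Fc : cyclic_map F.
  apply: (cyclic_map_tensor Fl FK) => a b c d; rewrite !FE !EE.
  by rewrite (mulrC (psi c)) -mulrDr Dc mulr0.
have Fcc : cyclic_cocycle F.
  apply: (cyclic_cocycle_tensor Fc) => a b c d e f.
  rewrite !tensorM !FE !EE !psiM.
  transitivity ((psi a * psi c * psi e)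
                * (D (b ** d) f + D (d ** f) b + D (f ** b) d)); first by ring.
  by rewrite Dcc mulr0.
have Fder : derivation F by split=> //; [exists K | exact/cyclic_cocycleP].
have [a0 pa0] := character_normalized ch.
apply: (@approximately_inner_descends B T D F (fun b => tensor a0 b)
  (fun b => tensor (a0 ** a0) b) (nrm a0) (nrm (a0 ** a0))) (ET F Fder Fc).
- by move=> b; rewrite nrm_tensor_le.
- by move=> k x y; rewrite tensorDr tensorZr.
- by move=> b; rewrite nrm_tensor_le.
- by move=> b d; rewrite tensorM.
- by move=> b d; rewrite FE EE pa0 !mul1r.
Qed.

End Amenability.
End CyclicDerivations.

Theorem theorem3p4 (R : realType) (A B : banachAlgType R[i])
    (chA : character_space A !=set0) (chB : character_space B !=set0) :
  (approx_cyclic_amenable (proj_tensor A B) ->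
     approx_cyclic_amenable A /\ approx_cyclic_amenable B) /\
  (commutative_algebra A ->
     approx_cyclic_amenable (proj_tensor A A) -> approx_cyclic_amenable A).
Proof.
split=> [AB | _ AA]; last exact: approx_cyclic_amenable_left AA.
by split; [exact: approx_cyclic_amenable_left AB
          | exact: approx_cyclic_amenable_right AB].
Qed.
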